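(* Assume that Ruzsa's genus conjecture holds: for every linear equation $E$ of genus one, $r_E(m) \geq m^{1-o(1)}$ as $m\to\infty$. Then there exists a triangle-free tripartite graph $H$ which is not $K_3$-abundant.
   Context: A linear equation $E$: $\sum_{i=1}^k a_i x_i = 0$ with integer coefficients has genus one if $\sum_{i=1}^k a_i=0$ but $\sum_{i \in T} a_i \neq 0$ for all $\varnothing \subsetneq T \subsetneq [k]$, where $[k]=\{1,\dots,k\}$. Integers $y_1,\dots,y_k$ form a non-trivial solution to $E$ if $\sum_{i=1}^k a_i y_i=0$ and the $y_i$ are not all equal. $r_E(m)$ is the maximum size of a subset of $[m]$ containing no non-trivial solution to $E$ (i.e. no non-trivial solution with all $y_i$ in the subset). The bound $m^{1-o(1)}$ means $m^{1-\eta(m)}$ for some function $\eta(m)\to 0$ as $m\to\infty$ (depending on $E$). All graphs are finite and simple. An $n$-vertex graph is $\varepsilon$-far from triangle-free if it cannot be made triangle-free by deleting fewer than $\varepsilon n^2$ edges. A graph $H$ is $K_3$-abundant if there exists $C_H>0$ such that for all $0<\varepsilon \leq \frac 12$, there is $n_0=n_0(\varepsilon,H)$ such that for all $n\ge n_0$ and every $n$-vertex graph $G$ which is $\varepsilon$-far from triangle-free, the number of copies of $H$ in $G$ (subgraphs of $G$ isomorphic to $H$) is at least $\varepsilon^{C_H} \cdot n^{|V(H)|}$. A graph is tripartite if its vertex set can be partitioned into three independent sets. *)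

(* Defs.v *)
From HB Require Import structures.
From mathcomp Require Import all_boot all_order all_algebra.
From mathcomp Require Import all_classical all_reals all_analysis.

Set Implicit Arguments.
Unset Strict Implicit.
Unset Printing Implicit Defensive.

Import Order.TTheory GRing.Theory Num.Theory.
Import numFieldNormedType.Exports.
Local Open Scope ring_scope.

(* The equation a_1 x_1 + ... + a_k x_k = 0 is given by its coefficients
   [a : 'I_k -> int]. *)

Definition genus_one (k : nat) (a : 'I_k -> int) : Prop :=
  \sum_i a i = 0 /\
  forall T : {set 'I_k}, T != finset.set0 -> T != [set: 'I_k]%SET ->
    \sum_(i in T) a i != 0.

Definition nontrivial_solution (k : nat) (a y : 'I_k -> int) : bool :=
  (\sum_i a i * y i == 0) && ~~ [forall i, forall j, y i == y j].

(* Subsets of [m] = {1, ..., m} are encoded as sets of ordinals in 'I_m.+1 that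
   do not contain 0, so that each ordinal stands for its own value. *)
Definition solution_free (k : nat) (a : 'I_k -> int) (m : nat)
    (A : {set 'I_m.+1}) : bool :=
  [forall y : {ffun 'I_k -> 'I_m.+1},
    [forall i, y i \in A] ==> ~~ nontrivial_solution a (fun i => (y i)%:Z)].

Definition r_max (k : nat) (a : 'I_k -> int) (m : nat) : nat :=
  (\max_(A : {set 'I_m.+1} | (ord0 \notin A) && solution_free a A) #|A|)%N.

Definition ruzsa_genus_conjecture (R : realType) : Prop :=
  forall (k : nat) (a : 'I_k -> int), genus_one a ->
    exists2 eta : nat -> R, (eta n @[n --> \oo] --> (0 : R))%classic &
      (\forall m \near \oo, m%:R `^ (1 - eta m) <= (r_max a m)%:R)%classic.

Record sgraph := SGraph {
  vertex :> finType;
  adj : rel vertex;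
  adj_sym : symmetric adj;
  adj_irrefl : irreflexive adj }.

Definition edges (G : sgraph) : {set {set G}} :=
  [set e | [exists x, exists y, adj x y && (e == [set x; y])]]%SET.

Definition triangle_free (G : sgraph) : Prop :=
  forall x y z : G, ~~ [&& adj x y, adj y z & adj z x].

Definition independent (G : sgraph) (A : {set G}) : Prop :=
  forall x y : G, x \in A -> y \in A -> ~~ adj x y.

Definition tripartite (G : sgraph) : Prop :=
  exists V1 V2 V3 : {set G},
    [/\ [/\ independent V1, independent V2 & independent V3],
        [/\ [disjoint V1 & V2], [disjoint V1 & V3] & [disjoint V2 & V3]]
      & V1 :|: V2 :|: V3 = [set: G]]%SET.

Section DeleteEdges.
Variables (G : sgraph) (F : {set {set G}}).

Definition del_adj : rel G := fun x y => adj x y && ([set x; y]%SET \notin F).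

Fact del_adj_sym : symmetric del_adj.
Proof. by move=> x y; rewrite /del_adj adj_sym finset.setUC. Qed.

Fact del_adj_irrefl : irreflexive del_adj.
Proof. by move=> x; rewrite /del_adj adj_irrefl. Qed.

Definition del_edges : sgraph := SGraph del_adj_sym del_adj_irrefl.

End DeleteEdges.

Definition far_from_triangle_free (R : realType) (eps : R) (G : sgraph) : Prop :=
  forall F : {set {set G}}, F \subset edges G ->
    #|F|%:R < eps * #|vertex G|%:R ^+ 2 -> ~ triangle_free (del_edges F).

(* A subgraph of [G] is a pair of a vertex set and an edge set. *)
Definition is_subgraph (G : sgraph) (S : {set G} * {set {set G}}) : bool :=
  (S.2 \subset edges G) && [forall e in S.2, e \subset S.1].

(* [f] is an isomorphism from [H] onto [S], assuming [is_subgraph S]. *)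
Definition iso_to (H G : sgraph) (S : {set G} * {set {set G}}) : bool :=
  [exists f : {ffun H -> G},
    [&& injectiveb f, (f @: [set: H])%SET == S.1
      & [forall x, forall y, adj x y == ([set f x; f y]%SET \in S.2)]]].

Definition copies (H G : sgraph) : nat :=
  #|[set S : {set G} * {set {set G}} | is_subgraph S && iso_to H S]%SET|.

Definition K3_abundant (R : realType) (H : sgraph) : Prop :=
  exists2 C : R, 0 < C &
    forall eps : R, 0 < eps <= 1 / 2 ->
      exists n0 : nat, forall G : sgraph, (n0 <= #|vertex G|)%N ->
        far_from_triangle_free eps G ->
        eps `^ C * #|vertex G|%:R ^+ #|vertex H| <= (copies H G)%:R.

(* Main.v *)
Require Import Defs.
From mathcomp Require Import all_boot all_order all_algebra all_fingroup.
From mathcomp Require Import all_classical all_reals all_analysis.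
From mathcomp Require Import zify ring lra.

Set Implicit Arguments.
Unset Strict Implicit.
Unset Printing Implicit Defensive.

Import Order.TTheory GRing.Theory Num.Theory.
Import numFieldNormedType.Exports.
Local Open Scope ring_scope.

(* Take a subset A of [m] without non-trivial solutions to one equation of genus one,
   and the Ruzsa-Szemeredi graph G whose triangles are x, x + a, x + 86 a with a in A.
   A homomorphism of H to G is a 3-colouring of H with a label in A on each
   edge, and every circulation on a subgraph of H imposes a linear equation on the
   labels. We choose a triangle-free graph with a positive circulation whose equation
   has genus one: the three classes of arcs carry multiples of 3, 4 and 7 and 84 in
   total, so a set of arcs carrying the same amount in each class is empty or full.
   Hence all labels of the subgraph agree and the homomorphism identifies two
   vertices. The graph H contains six copies of this graph together with gadgets
   forcing every 3-colouring of H to be the intended one on some copy, so no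
   homomorphism of H to G is injective. In a blow-up of G, of order n, the density of
   copies of H is then O(1/m), while the blow-up is m^(-o(1))-far from triangle-free. *)

(** * Proper 3-colourings *)

Definition proper_coloring (G : sgraph) (C : Type) (k : G -> C) : Prop :=
  forall x y : G, adj x y -> k x <> k y.

Lemma tripartite_of_coloring (G : sgraph) (k : G -> 'I_3) :
  proper_coloring k -> tripartite G.
Proof.
move=> kP; pose V c := [set x | k x == c]%SET.
have VI c : independent (V c).
  move=> x y; rewrite !inE => /eqP xc /eqP yc; apply/negP => /kP.
  by rewrite xc yc.
have VD c d : c != d -> [disjoint V c & V d].
  move=> cd; apply/pred0P => x /=; rewrite !inE.
  by apply/negP => /andP[/eqP -> /eqP e]; rewrite e eqxx in cd.
exists (V 0), (V 1), (V 2%:R); split; [by split|split; exact: VD|].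
apply/setP => x; rewrite !inE.
by case: (k x) => -[|[|[|]]] //= i; rewrite -!val_eqE.
Qed.

Lemma ord3_succ (c d : 'I_3) : c != d -> d = c + 1 \/ c = d + 1.
Proof.
case: c => -[|[|[|]]] // ?; case: d => -[|[|[|]]] // ?; rewrite -!val_eqE //= => _;
by [left; apply: val_inj|right; apply: val_inj].
Qed.

Lemma ord3_succ_neq (c : 'I_3) : (c + 1 != c) && (c + 1 + 1 != c).
Proof. by case: c => -[|[|[|]]] // ?; rewrite -!val_eqE. Qed.

(** * The gadget that forces two vertices to share a colour *)

(** Backtracking search: [cs] holds the colours chosen so far, and each entry of [nbrs] lists the
    earlier neighbours of the next vertex. Reaching the end of [nbrs] means that a 3-colouring was
    found. *)
Fixpoint uncolorable (nbrs : seq (seq nat)) (cs : seq nat) : bool :=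
  if nbrs is p :: nbrs' then
    all (fun c => has (fun j => nth 0%N cs j == c) p || uncolorable nbrs' (rcons cs c))
      [:: 0; 1; 2]%N
  else false.

(** The colours of [g] trace a branch of the search that no conflict closes. *)
Lemma uncolorableP (g : nat -> nat) (nbrs : seq (seq nat)) (n : nat) :
  (forall i, (g i < 3)%N) ->
  (forall i, (i < size nbrs)%N -> all (fun j => (j < n + i)%N && (g j != g (n + i)%N))
     (nth [::] nbrs i)) ->
  ~~ uncolorable nbrs (mkseq g n).
Proof.
move=> g3; elim: nbrs n => [//|p nbrs IH n gP].
apply/negP => nocol; have /(_ (g n)) := @allP _ _ [:: 0; 1; 2]%N nocol.
have -> : (g n \in [:: 0; 1; 2]%N) by case: (g n) (g3 n) => [|[|[|]]].
move=> /(_ isT)/orP[/hasP[j jp]|].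
  have /= := allP (gP 0%N isT) j jp.
  by rewrite addn0 => /andP[jn /negbTE]; rewrite nth_mkseq // => ->.
rewrite -mkseqS; apply/negP/IH => i i_lt.
by have := gP i.+1 i_lt; rewrite addnS.
Qed.

(* The Groetzsch graph with an edge st removed: 0, ..., 4 is the pentagon,
   5, ..., 8 are the twins of 1, ..., 4, and t is the twin of 0. *)
Definition gadget_edges : seq (nat * nat) :=
  [:: (0,1); (1,2); (2,3); (3,4); (4,0);
      (5,0); (5,2); (6,1); (6,3); (7,2); (7,4); (8,3); (8,0)]%N.

Definition gadget_nat : rel nat := fun i j =>
  ((i, j) \in gadget_edges) || ((j, i) \in gadget_edges).

Definition gadget_adj : rel 'I_9 := fun i j => gadget_nat i j.

Lemma gadget_adj_sym : symmetric gadget_adj.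
Proof. by move=> i j; rewrite /gadget_adj /gadget_nat orbC. Qed.

Definition gadget_s : pred 'I_9 := fun i => (i : nat) \in [:: 5; 6; 7; 8]%N.
Definition gadget_t : pred 'I_9 := fun i => (i : nat) \in [:: 1; 4]%N.

(* The neighbours preceding each vertex of the full Groetzsch graph, in the order
   s, t, 0, ..., 8. *)
Definition groetzsch_nbrs : seq (seq nat) :=
  [:: [::]; [:: 0]; [::]; [:: 1; 2]; [:: 3]; [:: 4]; [:: 5; 2; 1];
      [:: 0; 2; 4]; [:: 0; 3; 5]; [:: 0; 4; 6]; [:: 0; 5; 2]]%N.

(** If [ks] and [kt] differed, the edge st could be put back, giving a 3-colouring of the Groetzsch
    graph, whose chromatic number is 4. *)
Lemma gadget_forces_eq (k : 'I_9 -> 'I_3) (ks kt : 'I_3) :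
  (forall i j, gadget_adj i j -> k i != k j) ->
  (forall i, gadget_s i -> ks != k i) ->
  (forall i, gadget_t i -> kt != k i) -> ks = kt.
Proof.
move=> kP sP tP; apply/eqP/negPn/negP => st.
pose g i : nat := if i is i'.+1 then if i' is i''.+1 then k (inord i'') else kt else ks.
have kk i j : gadget_adj (inord i) (inord j) -> g i.+2 != g j.+2 by move=> /kP.
suff : ~~ uncolorable groetzsch_nbrs (mkseq g 0) by [].
apply: uncolorableP.
- by case=> [|[|i]] /=.
have ss i : gadget_s (inord i) -> g 0%N != g i.+2 by move=> /sP.
have tt i : gadget_t (inord i) -> g 1%N != g i.+2 by move=> /tP.
have s01 : g 0%N != g 1%N by [].
move=> i; do 11?[case: i => [|i] //=] => _.
all: rewrite ?add0n ?s01 ?andbT //=; repeat (apply/andP; split => //).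
all: by [apply: kk; rewrite // /gadget_adj !inordK
        |apply: ss; rewrite // /gadget_s inordK
        |apply: tt; rewrite // /gadget_t inordK].
Qed.

(** * Attaching gadgets to pairs of equally coloured vertices *)

Section Rigidification.
Variables (B : sgraph) (col : B -> 'I_3).

(** Every pair (s, t) owns a gadget copy, so that the vertex type stays a plain product; copies of
    pairs that are equal or differently coloured are left unattached. *)
Definition attached (u s t : B) (i : 'I_9) : bool :=
  [&& s != t, col s == col t & (u == s) && gadget_s i || (u == t) && gadget_t i].

Definition rigid_adj : rel (B + B * B * 'I_9) := fun x y =>
  match x, y with
  | inl u, inl v => adj u v
  | inl u, inr (s, t, i) => attached u s t i
  | inr (s, t, i), inl u => attached u s t i
  | inr (p, i), inr (q, j) => (p == q) && gadget_adj i j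
  end.

Lemma rigid_adj_sym : symmetric rigid_adj.
Proof.
move=> [u|[[s t] i]] [v|[[s' t'] j]] //=; first exact: adj_sym.
by rewrite eq_sym gadget_adj_sym.
Qed.

Lemma rigid_adj_irrefl : irreflexive rigid_adj.
Proof.
move=> [u|[[s t] i]] /=; first exact: adj_irrefl.
by rewrite eqxx; case: i; do 9?[case=> //].
Qed.

Definition rigid : sgraph := SGraph rigid_adj_sym rigid_adj_irrefl.

Hypothesis col_proper : proper_coloring col.

Lemma rigid_coloring_eq (k : rigid -> 'I_3) (u v : B) :
  proper_coloring k -> col u = col v -> k (inl u) = k (inl v).
Proof.
move=> kP uv; have [->//|uDv] := eqVneq u v.
apply: (@gadget_forces_eq (fun i => k (inr (u, v, i)))) => [i j ij|i si|i ti];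
  apply/eqP/kP; by rewrite /= /attached ?uv ?uDv ?eqxx ?si ?ti ?orbT.
Qed.

(** The list 3-colours the gadget compatibly with colour 0 on both s and t; it is then shifted by
    the colour of s. *)
Definition rigid_color (x : rigid) : 'I_3 :=
  match x with
  | inl u => col u
  | inr (s, t, i) => col s + inord (nth 0%N [:: 0; 1; 0; 1; 2; 1; 2; 1; 2]%N i)
  end.

Lemma rigid_color_proper : proper_coloring rigid_color.
Proof.
have att (u s t : B) i : attached u s t i ->
    col u <> col s + inord (nth 0%N [:: 0; 1; 0; 1; 2; 1; 2; 1; 2]%N i).
  move=> /and3P[_ /eqP st /orP[]/andP[/eqP -> ii]]; rewrite -?st => /esym/eqP;
  rewrite -subr_eq0 addrC addKr -val_eqE /=;
  by case: i ii; do 9?[case=> //] => ? _; rewrite inordK.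
move=> [u|[[s t] i]] [v|[[s' t'] j]] /=; first exact: col_proper.
- exact: att.
- by move=> /att /[swap] ->.
move=> /andP[/eqP[-> _] ij] /addrI /(congr1 val).
case: i ij => i i9; case: j => j j9 /=.
by do 9?[case: i i9 => [|i] i9 //]; do 9?[case: j j9 => [|j] j9 //] => _;
   rewrite /= !inordK.
Qed.

Lemma rigid_tripartite : tripartite rigid.
Proof. exact: tripartite_of_coloring rigid_color_proper. Qed.

Lemma gadget_triangle_free (i j l : 'I_9) :
  ~~ [&& gadget_adj i j, gadget_adj j l & gadget_adj l i].
Proof.
have cyc : all (fun i => all (fun j => all (fun l => ~~ [&& gadget_nat i j, gadget_nat j l
  & gadget_nat l i]) (iota 0 9)) (iota 0 9)) (iota 0 9) by [].
have io (x : 'I_9) : (x : nat) \in iota 0 9 by rewrite mem_iota ltn_ord.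
exact: allP (allP (allP cyc _ (io i)) _ (io j)) _ (io l).
Qed.

(** A terminal s or t has no two adjacent neighbours in its gadget, and two vertices attached to the
    same gadget have the same colour, hence are not adjacent in [B]. *)
Lemma rigid_triangle_free : triangle_free B -> triangle_free rigid.
Proof.
have ss i j : gadget_adj i j -> ~~ (gadget_s i && gadget_s j).
  by case: i => i i9; case: j => j j9;
    do 9?[case: i i9 => [|i] i9 //]; do 9?[case: j j9 => [|j] j9 //].
have tt i j : gadget_adj i j -> ~~ (gadget_t i && gadget_t j).
  by case: i => i i9; case: j => j j9;
    do 9?[case: i i9 => [|i] i9 //]; do 9?[case: j j9 => [|j] j9 //].
have one u s t i j : attached u s t i -> attached u s t j -> ~~ gadget_adj i j.
  move=> /and3P[st _ ui] /and3P[_ _ uj]; apply/negP => ij.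
  move: (ss _ _ ij) (tt _ _ ij); rewrite !negb_and.
  case/orP: ui uj => /andP[/eqP -> ->];
    rewrite eqxx ?(negbTE st) 1?eq_sym ?(negbTE st) /= ?orbF.
    by move=> ->.
  by move=> ->.
have two u v s t i j : adj u v -> attached u s t i -> ~~ attached v s t j.
  move=> uv /and3P[st /eqP cst ui]; apply/negP => /and3P[_ _ vj].
  have : col u = col v.
    by case/orP: ui => /andP[/eqP -> _]; case/orP: vj => /andP[/eqP -> _].
  exact: col_proper.
move=> Bfree [u|[[s t] i]] [v|[[s' t'] j]] [w|[[s'' t''] l]]; apply/negP => /=.
- exact/negP/Bfree.
- move=> /and3P[uv vl ul]; have := two _ _ _ _ _ l uv ul; by rewrite vl.
- move=> /and3P[uv vl ul]; have := two _ _ _ _ _ j ul vl; by rewrite uv.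
- by move=> /and3P[uj /andP[/eqP[<- <-] jl] /one/(_ uj)]; rewrite gadget_adj_sym jl.
- move=> /and3P[vi vw wi]; have := two _ _ _ _ _ i vw vi; by rewrite wi.
- by move=> /and3P[vi vl /andP[/eqP[e1 e2] li]]; subst; have := one _ _ _ _ _ vl vi; rewrite li.
- by move=> /and3P[/andP[/eqP[e1 e2] li] vi vl]; subst; have := one _ _ _ _ _ vl vi; rewrite li.
- move=> /and3P[/andP[_ ij] /andP[_ jl] /andP[_ li]].
  by have := gadget_triangle_free i j l; rewrite ij jl li.
Qed.

End Rigidification.

(** * The circulation and its equation of genus one *)

(* Arcs (source, target, value). The vertex classes are {0..3}, {4..10}, {11..13}.
   The arcs between two consecutive classes carry multiples of 3, 4, 7
   respectively, and every class of arcs carries 84 = 3 * 4 * 7 in total. *)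
Definition flow : seq (nat * nat * nat) :=
  [:: (0,4,12); (0,5,9); (1,5,3); (1,6,12); (1,7,6); (2,7,6); (2,8,12); (2,9,3);
      (3,9,9); (3,10,12);
      (4,11,12); (5,11,12); (6,11,4); (6,12,8); (7,12,12); (8,12,8); (8,13,4);
      (9,13,12); (10,13,12);
      (13,1,21); (13,0,7); (12,0,14); (12,3,14); (11,3,7); (11,2,21)]%N.

Definition src_at (i : nat) : nat := (nth (0, 0, 0) flow i).1.1%N.
Definition tgt_at (i : nat) : nat := (nth (0, 0, 0) flow i).1.2%N.
Definition value (i : nat) : nat := (nth (0, 0, 0) flow i).2%N.

Definition cls (v : nat) : 'I_3 :=
  if (v < 4)%N then 0 else if (v < 11)%N then 1 else 2%:R.

(* Since 85 > 84, sums s0, s1, s2 in [0, 84] with s0 + 85 s1 - 86 s2 = 0 are equal. *)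
Definition step (c : 'I_3) : int := nth 0 [:: 1; 85; -86] c.

(** An arc with label y shifts the position by [step] times y; this is the factor of y once the
    circulation weighs the shift by [value]. *)
Definition coef (i : 'I_25) : int := (value i)%:Z * step (cls (src_at i)).

Lemma flow_arcP (i : 'I_25) :
  [/\ (src_at i < 14)%N, (tgt_at i < 14)%N, cls (tgt_at i) = cls (src_at i) + 1,
      (0 < value i)%N & (nth 1%N [:: 3; 4; 7]%N (cls (src_at i)) %| value i)%N].
Proof.
have arcs : all (fun i => [&& (src_at i < 14)%N, (tgt_at i < 14)%N,
    cls (tgt_at i) == cls (src_at i) + 1, (0 < value i)%N &
    (nth 1%N [:: 3; 4; 7]%N (cls (src_at i)) %| value i)%N]) (iota 0 25) by [].
have /(_ i) := allP arcs; rewrite mem_iota ltn_ord => /(_ isT).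
by move=> /and5P[? ? /eqP ? ? ?].
Qed.

(** Inflow equals outflow at each vertex, so every term [pos v] cancels. *)
Lemma flow_circulation (pos : nat -> int) :
  \sum_(i < 25) (value i)%:Z * (pos (tgt_at i) - pos (src_at i)) = 0.
Proof.
rewrite !big_ord_recl big_ord0 /value /tgt_at /src_at /=; ring.
Qed.

Definition class_sum (T : {set 'I_25}) (c : 'I_3) : nat :=
  (\sum_(i in T | cls (src_at i) == c) value i)%N.

Lemma class_sum_setT (c : 'I_3) : class_sum [set: 'I_25]%SET c = 84%N.
Proof.
rewrite /class_sum; under eq_bigl do rewrite inE.
rewrite big_mkcond !big_ord_recl big_ord0.
by case: c => -[|[|[|]]] // ?; vm_compute.
Qed.

Lemma class_sumC (T : {set 'I_25}) (c : 'I_3) :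
  (class_sum T c + class_sum (~: T)%SET c = 84)%N.
Proof.
rewrite -(class_sum_setT c) {3}/class_sum (bigID (fun i => i \in T)) /=.
by congr addn; apply: eq_bigl => i; rewrite !inE //= andbC.
Qed.

Lemma class_sum_dvd (T : {set 'I_25}) (c : 'I_3) :
  (nth 1%N [:: 3; 4; 7]%N c %| class_sum T c)%N.
Proof. by apply: dvdn_sum => i /andP[_ /eqP <-]; case: (flow_arcP i). Qed.

Lemma class_sum_eq0 (T : {set 'I_25}) :
  (forall c, class_sum T c = 0%N) -> T = finset.set0.
Proof.
move=> T0; apply/setP => i; rewrite !inE; apply/negP => iT.
have /eqP := T0 (cls (src_at i)); rewrite /class_sum (bigD1 i) ?iT ?eqxx //=.
by case: (flow_arcP i) => _ _ _; case: (value i).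
Qed.

Lemma sum_coef (T : {set 'I_25}) :
  \sum_(i in T) coef i = \sum_c step c * (class_sum T c)%:Z.
Proof.
rewrite (partition_big (fun i : 'I_25 => cls (src_at i)) predT) //=.
apply: eq_bigr => c _; rewrite /class_sum (big_morph Posz PoszD (erefl _)) mulr_sumr.
by apply: eq_bigr => i /andP[_ /eqP <-]; rewrite mulrC.
Qed.

Lemma coef_genus_one : genus_one coef.
Proof.
have sum3 (T : {set 'I_25}) : \sum_(i in T) coef i =
    (class_sum T 0)%:Z + 85 * (class_sum T 1)%:Z - 86 * (class_sum T 2%:R)%:Z.
  have sum_ord3 (f : 'I_3 -> int) : \sum_c f c = f 0 + f 1 + f 2%:R.
    rewrite !big_ord_recl big_ord0 addr0 addrA.
    by congr (_ + f _ + f _); apply: val_inj.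
  rewrite sum_coef sum_ord3.
  have [-> -> ->] : [/\ step 0 = 1, step 1 = 85 & step 2%:R = -86] by [].
  by rewrite mul1r mulNr.
split.
  rewrite (eq_bigl (fun i => i \in [set: 'I_25]%SET)); last by move=> i; rewrite inE.
  by rewrite sum3 !class_sum_setT; lia.
move=> T T0 TT; apply/negP => /eqP; rewrite sum3 => e.
(* The equation reads (s0 - s1) + 86 (s1 - s2) = 0, and |s0 - s1| is at most 84. *)
have eqc : class_sum T 0 = class_sum T 1 /\ class_sum T 1 = class_sum T 2%:R.
  by have := class_sumC T 0; have := class_sumC T 1; have := class_sumC T 2%:R; lia.
have all_eq c : class_sum T c = class_sum T 0.
  have : [|| c == 0, c == 1 | c == 2%:R] by case: c => -[|[|[|]]].
  by case/or3P => /eqP ->; case: eqc => -> ->.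
(* The common sum is a multiple of 84 and at most 84; if it is 0 then [T] is empty, and if it is 84
   then the complement is. *)
have d : (84 %| class_sum T 0%R)%N.
  rewrite (_ : 84 = 3 * 4 * 7)%N // !Gauss_dvd //.
  by rewrite (class_sum_dvd T 0) -{1}(all_eq 1) (class_sum_dvd T 1) -(all_eq 2%:R)
    (class_sum_dvd T 2%:R).
have [S0|Sn0] := posnP (class_sum T 0).
  by move/eqP: T0; apply; apply: class_sum_eq0 => c; rewrite all_eq.
move/eqP: TT; apply; apply: finset.setC_inj; rewrite finset.setCT.
apply: class_sum_eq0 => c; have := class_sumC T c; rewrite all_eq.
by have := dvdn_leq Sn0 d; lia.
Qed.

(** * The flow graph and its six copies *)

Definition flow_adj : rel 'I_14 := fun u v =>
  has (fun e => ((e.1.1 == u :> nat) && (e.1.2 == v :> nat))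
             || ((e.1.1 == v :> nat) && (e.1.2 == u :> nat))) flow.

Lemma flow_adj_sym : symmetric flow_adj.
Proof. by move=> u v; apply: eq_has => e; rewrite orbC. Qed.

Lemma flow_adj_cls (u v : 'I_14) : flow_adj u v -> cls u != cls v.
Proof.
have ok : all (fun e => cls e.1.1 != cls e.1.2) flow by [].
move=> /hasP[e /(allP ok) H] /orP[]/andP[/eqP <- /eqP <-] //.
by rewrite eq_sym.
Qed.

Lemma flow_adj_irrefl : irreflexive flow_adj.
Proof. by move=> u; apply/negP => /flow_adj_cls; rewrite eqxx. Qed.

Lemma flow_adj_triangle_free (u v w : 'I_14) :
  ~~ [&& flow_adj u v, flow_adj v w & flow_adj w u].
Proof.
pose fadj (u v : nat) := has (fun e => ((e.1.1 == u) && (e.1.2 == v))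
             || ((e.1.1 == v) && (e.1.2 == u))) flow.
have ok : all (fun e => all (fun w => ~~ (fadj e.1.2 w && fadj w e.1.1)) (iota 0 14)) flow
  by [].
have iow : (w : nat) \in iota 0 14 by rewrite mem_iota ltn_ord.
apply/negP => /and3P[/hasP[e /(allP ok) /allP /(_ _ iow) H]].
case/orP => /andP[/eqP eu /eqP ev] vw wu; move: H; rewrite eu ev.
  by rewrite [fadj _ _]vw [fadj _ _]wu.
by rewrite [fadj _ _](etrans (flow_adj_sym _ _) wu) [fadj _ _](etrans (flow_adj_sym _ _) vw).
Qed.

(* The six copies of the flow graph carry all six assignments of the colours to
   the classes, so one of them matches any given colouring. *)
Definition base_adj : rel ({perm 'I_3} * 'I_14) := fun x y =>
  (x.1 == y.1) && flow_adj x.2 y.2.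

Lemma base_adj_sym : symmetric base_adj.
Proof. by move=> x y; rewrite /base_adj eq_sym flow_adj_sym. Qed.

Lemma base_adj_irrefl : irreflexive base_adj.
Proof. by move=> x; rewrite /base_adj flow_adj_irrefl andbF. Qed.

Definition base : sgraph := SGraph base_adj_sym base_adj_irrefl.

Definition base_color (x : base) : 'I_3 := x.1 (cls x.2).

Lemma base_color_proper : proper_coloring base_color.
Proof.
move=> [s u] [t v] /andP[/= /eqP <-] /flow_adj_cls /eqP uv /perm_inj.
exact: uv.
Qed.

Lemma base_triangle_free : triangle_free base.
Proof.
move=> x y z; apply/negP => /and3P[/andP[_ xy] /andP[_ yz] /andP[_ zx]].
by have := flow_adj_triangle_free x.2 y.2 z.2; rewrite xy yz zx.
Qed.

Definition src (i : 'I_25) : 'I_14 := inord (src_at i).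
Definition tgt (i : 'I_25) : 'I_14 := inord (tgt_at i).

Lemma srcE i : src i = src_at i :> nat.
Proof. by rewrite inordK //; case: (flow_arcP i). Qed.

Lemma tgtE i : tgt i = tgt_at i :> nat.
Proof. by rewrite inordK //; case: (flow_arcP i). Qed.

Lemma flow_adj_arc (i : 'I_25) : flow_adj (src i) (tgt i).
Proof.
apply/hasP; exists (nth (0, 0, 0)%N flow i); first exact: mem_nth.
by rewrite srcE tgtE !eqxx.
Qed.

(** The colouring factors through [base_color] by a map t of colours. Any two classes are joined by
    an arc, so t is injective, and the copy indexed by its inverse is coloured by [cls]. *)
Lemma base_coloring (k : base -> 'I_3) :
  proper_coloring k -> (forall x y, base_color x = base_color y -> k x = k y) ->
  exists s : {perm 'I_3}, forall v : 'I_14, k (s, v) = cls v.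
Proof.
move=> kP kcol.
pose rep (c : 'I_3) : 'I_14 := inord (nth 0%N [:: 0; 4; 11]%N c).
have cls_rep c : cls (rep c) = c.
  by case: c => -[|[|[|]]] // ?; rewrite /rep inordK //; apply: val_inj.
pose t c := k (1%g, rep c).
have kt (s : {perm 'I_3}) (v : 'I_14) : k (s, v) = t (s (cls v)).
  by apply: kcol; rewrite /base_color /= perm1 cls_rep.
have t_succ c : t c != t (c + 1).
  (* Arcs 0, 10 and 19 of [flow] leave the classes 0, 1 and 2. *)
  pose i : 'I_25 := inord (nth 0%N [:: 0; 10; 19]%N c).
  have ti : cls (src i) = c.
    by rewrite srcE; case: c @i => -[|[|[|]]] // ?; rewrite /= inordK //; apply: val_inj.
  have hi : cls (tgt i) = c + 1.
    by rewrite -ti tgtE srcE; case: (flow_arcP i).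
  have := kt 1%g (src i); have := kt 1%g (tgt i); rewrite !perm1 ti hi => <- <-.
  by apply/eqP/kP; rewrite /= /base_adj eqxx flow_adj_arc.
have t_inj : injective t.
  move=> c d tcd; apply/eqP/negPn/negP => /ord3_succ [] e.
    by have := t_succ c; rewrite -e tcd eqxx.
  by have := t_succ d; rewrite -e tcd eqxx.
by exists (perm t_inj)^-1%g => v; rewrite kt -[RHS](permKV (perm t_inj)) permE.
Qed.

(** * The blown-up Cayley graph and its homomorphisms *)

Section CayleyGraph.
Variables (m b : nat) (A : {set 'I_m.+1}).

(** Class, position and blow-up index; adjacency ignores the last. Positions up to 87 m leave room
    for x + 86 a with x < m and a <= m. *)
Definition cayley_vertex : finType := ('I_3 * 'I_(87 * m).+1 * 'I_b.+1)%type.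

Definition arc (u v : cayley_vertex) : bool :=
  (v.1.1 == u.1.1 + 1) &&
  [exists a in A, (v.1.2)%:Z - (u.1.2)%:Z == step u.1.1 * (a : nat)%:Z].

Definition cayley_adj : rel cayley_vertex := fun u v => arc u v || arc v u.

Lemma cayley_adj_sym : symmetric cayley_adj.
Proof. by move=> u v; rewrite /cayley_adj orbC. Qed.

Lemma cayley_adj_irrefl : irreflexive cayley_adj.
Proof.
move=> u; rewrite /cayley_adj orbb /arc eq_sym.
by have /andP[/negbTE -> _] := ord3_succ_neq u.1.1.
Qed.

Definition cayley : sgraph := SGraph cayley_adj_sym cayley_adj_irrefl.

Lemma card_cayley : #|vertex cayley| = (3 * (87 * m).+1 * b.+1)%N.
Proof. by rewrite /= !card_prod !card_ord. Qed.

Lemma cayley_adj_class (u v : cayley) : adj u v -> u.1.1 != v.1.1.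
Proof.
case/orP => /andP[/eqP -> _]; first rewrite eq_sym.
  by case/andP: (ord3_succ_neq u.1.1).
by case/andP: (ord3_succ_neq v.1.1).
Qed.

Lemma cayley_adj_arc (u v : cayley) : adj u v -> v.1.1 = u.1.1 + 1 -> arc u v.
Proof.
case/orP => // /andP[/eqP -> _] /esym/eqP.
by have /andP[_ /negbTE ->] := ord3_succ_neq v.1.1.
Qed.

(** On the copy coloured by [cls], the arc labels solve the equation, so they are all equal. Blow-up
    indices may still differ, hence the collapse of class and position only. *)
Lemma rigid_hom_collapse (f : rigid base_color -> cayley) :
  solution_free coef A -> (forall x y, adj x y -> adj (f x) (f y)) ->
  exists x y, x != y /\ (f x).1 = (f y).1.
Proof.
move=> Afree fP.
pose k x := (f x).1.1.
have kP : proper_coloring k by move=> x y /fP /cayley_adj_class /eqP.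
have [|x y xy|s sP] := @base_coloring (fun x => k (inl x)).
- by move=> x y xy; apply: kP.
- exact: rigid_coloring_eq.
pose g v : cayley := f (inl (s, v)).
have gP i : exists a : 'I_m.+1, a \in A /\
    (g (tgt i)).1.2%:Z - (g (src i)).1.2%:Z = step (cls (src_at i)) * (a : nat)%:Z.
  have : arc (g (src i)) (g (tgt i)).
    apply: cayley_adj_arc.
      by apply: fP; rewrite /= /base_adj eqxx flow_adj_arc.
    have := sP (tgt i); have := sP (src i); rewrite /k /g => -> ->.
    by rewrite tgtE srcE; case: (flow_arcP i).
  move=> /andP[_ /exists_inP[a aA /eqP e]]; exists a; split => //.
  by rewrite e; have := sP (src i); rewrite /k /g => ->; rewrite srcE.
have [y yP] := fin_all_exists gP.
have sol : \sum_i coef i * (y i : nat)%:Z = 0.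
  rewrite -[RHS](flow_circulation (fun v => (g (inord v)).1.2%:Z)).
  apply: eq_bigr => i _; rewrite /coef -mulrA; congr (_ * _).
  by case: (yP i).
have /forallP /(_ (finfun y)) /implyP := Afree.
have -> : [forall i, finfun y i \in A] by apply/forallP => i; rewrite ffunE; case: (yP i).
move=> /(_ isT); rewrite negb_and negbK; under eq_bigr do rewrite ffunE.
(* Arcs 0 and 1 both leave vertex 0; with equal labels, their targets 4 and 5 reach the same
   position. *)
rewrite sol eqxx /= => /forallP /(_ (inord 0)) /forallP /(_ (inord 1)) /eqP.
rewrite !ffunE => -[y01].
have t01 : src (inord 0) = src (inord 1) by rewrite /src !inordK.
exists (inl (s, tgt (inord 0))), (inl (s, tgt (inord 1))); split.
  rewrite /eq_op /= /eq_op /= eqxx /= -val_eqE /=.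
  by rewrite !tgtE !inordK.
have [_ e0] := yP (inord 0); have [_ e1] := yP (inord 1).
have c0 : (g (tgt (inord 0))).1.1 = (g (tgt (inord 1))).1.1.
  have := sP (tgt (inord 0)); have := sP (tgt (inord 1)); rewrite /k /g => -> ->.
  by rewrite !tgtE !inordK.
have p0 : (g (tgt (inord 0))).1.2 = (g (tgt (inord 1))).1.2.
  apply: val_inj => /=; by move: e0; rewrite y01 -!srcE t01 srcE -e1 => /addIr [].
have pair_eq (p q : 'I_3 * 'I_(87 * m).+1) : p.1 = q.1 -> p.2 = q.2 -> p = q.
  by case: p q => p1 p2 [q1 q2] /= -> ->.
exact: pair_eq c0 p0.
Qed.

End CayleyGraph.

(** * Counting copies through homomorphisms *)

Definition hom_set (H G : sgraph) : {set {ffun H -> G}} :=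
  [set f : {ffun H -> G} | [forall x, forall y, adj x y ==> adj (f x) (f y)]]%SET.

(** An isomorphism onto a copy is a homomorphism from which [S_of] recovers the copy. *)
Lemma copies_le_hom (H G : sgraph) : (copies H G <= #|hom_set H G|)%N.
Proof.
pose S_of (f : {ffun H -> G}) : {set G} * {set {set G}} :=
  ((f @: [set: H])%SET, [set e | [exists x, exists y, adj x y && (e == [set f x; f y])]]%SET).
apply: leq_trans (leq_imset_card S_of (hom_set H G)).
apply/subset_leq_card/fintype.subsetP => S; rewrite inE => /andP[/andP[/fintype.subsetP Sedges /forall_inP Ssub]].
move=> /existsP[f /and3P[f_inj /eqP S1 /forallP fadj]].
have fS x y : adj x y = ([set f x; f y]%SET \in S.2).
  by have /forallP /(_ y) /eqP := fadj x.
have edgeP (p q : G) : [set p; q]%SET \in edges G -> adj p q.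
  rewrite inE => /existsP[x /existsP[y /andP[xy /eqP e]]].
  have : x \in [set p; q]%SET by rewrite e !inE eqxx.
  have : y \in [set p; q]%SET by rewrite e !inE eqxx orbT.
  have xDy : x != y by apply: contraTneq xy => ->; rewrite adj_irrefl.
  rewrite !inE => /orP[]/eqP ey /orP[]/eqP ex; rewrite ex ey ?eqxx // in xy xDy.
  by rewrite adj_sym.
apply/imsetP; exists f.
  rewrite inE; apply/forallP => x; apply/forallP => y; apply/implyP.
  by rewrite fS => /Sedges /edgeP.
rewrite [S]surjective_pairing /S_of S1; congr pair; apply/setP => e; rewrite inE.
apply/idP/existsP => [eS|[x /existsP[y /andP[xy /eqP ->]]]]; last by rewrite -fS.
have := Sedges _ eS; rewrite inE => /existsP[p /existsP[q /andP[pq /eqP epq]]].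
have /fintype.subsetP eS1 := Ssub _ eS.
have /imsetP[x _ px] : p \in (f @: [set: H])%SET by rewrite S1 eS1 // epq !inE eqxx.
have /imsetP[y _ qy] : q \in (f @: [set: H])%SET by rewrite S1 eS1 // epq !inE eqxx orbT.
exists x; apply/existsP; exists y; rewrite fS -px -qy -epq eS eqxx //.
Qed.

(** Given f away from y, the first coordinate of f y is read off f x, and only its second one is
    free. *)
Lemma card_ffun_collapse (T U V : finType) (x y : T) : x != y ->
  (#|[set f : {ffun T -> U * V} | (f x).1 == (f y).1]%SET| <= #|{: U * V}| ^ #|T|.-1 * #|V|)%N.
Proof.
move=> xy; pose T' := {z : T | z != y}.
pose F (f : {ffun T -> U * V}) : {ffun T' -> U * V} * V := ([ffun z => f (val z)], (f y).2).
have -> : (#|{: U * V}| ^ #|T|.-1 * #|V| = #|{: {ffun T' -> U * V} * V}|)%N.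
  rewrite [RHS]card_prod card_ffun; congr (_ ^ _ * _)%N.
  by rewrite card_sig -(cardC1 y); apply: eq_card => z; rewrite !inE.
rewrite -(@card_in_imset _ _ F) ?max_card //.
move=> f g; rewrite !inE => /eqP fxy /eqP gxy [/ffunP fg fgy].
have fgz z : z != y -> f z = g z by move=> zy; have := fg (Sub z zy); rewrite !ffunE.
apply/ffunP => z; have [->|/fgz//] := eqVneq z y.
by rewrite [LHS]surjective_pairing [RHS]surjective_pairing -fxy -gxy (fgz x) // fgy.
Qed.

(** Union bound over the pairs of distinct vertices that a homomorphism may collapse. *)
Lemma copies_cayley_le (m b : nat) (A : {set 'I_m.+1}) :
  solution_free coef A ->
  (copies (rigid base_color) (cayley b A) <= #|vertex (rigid base_color)| ^ 2 *
     (#|vertex (cayley b A)| ^ #|vertex (rigid base_color)|.-1 * b.+1))%N.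
Proof.
move=> Afree; set H := rigid base_color; set n := #|vertex (cayley b A)|.
apply: leq_trans (copies_le_hom _ _) _.
pose V := cayley_vertex m b.
pose P (p : H * H) := [set f : {ffun H -> V} | (f p.1).1 == (f p.2).1]%SET.
apply: (@leq_trans (\sum_(p : H * H | p.1 != p.2) #|P p|)).
  have : hom_set H (cayley b A) \subset \bigcup_(p : H * H | p.1 != p.2) P p.
    apply/fintype.subsetP => f; rewrite inE => /forallP fP.
    have [|x [y [xy e]]] := @rigid_hom_collapse m b A f Afree.
      by move=> x y; have /forallP /(_ y) /implyP := fP x.
    by apply/bigcupP; exists (x, y); rewrite // inE e.
  move=> /subset_leq_card /leq_trans; apply.
  elim/big_rec2: _ => [|p S s _ IH]; first by rewrite cards0.
  by apply: leq_trans (leq_card_setU _ _) _; rewrite leq_add2l.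
apply: (@leq_trans (\sum_(p : H * H) n ^ #|vertex H|.-1 * b.+1)).
  rewrite big_mkcond; apply: leq_sum => p _; case: ifP => // pp.
  by apply: leq_trans (card_ffun_collapse _ _ pp) _; rewrite card_ord.
by rewrite sum_nat_const card_prod mulnn.
Qed.

(** * Edge-disjoint triangles and the distance from being triangle-free *)

Section Far.
Variables (m b : nat) (A : {set 'I_m.+1}).

Let index : finType := ('I_m * 'I_m.+1 * ('I_b.+1 * 'I_b.+1))%type.

(** With t = (x, a, (i, j)), the positions are x, x + a, x + 86 a and the blow-up indices i, j, i +
    j modulo b + 1. *)
Definition tri_vertex (t : index) (c : 'I_3) : cayley b A :=
  (c, inord (t.1.1 + nth 0 [:: 0; 1; 86] c * t.1.2)%N,
   nth 0 [:: t.2.1; t.2.2; t.2.1 + t.2.2] c).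

Definition tri_edge (t : index) (c : 'I_3) : {set cayley b A} :=
  [set tri_vertex t c; tri_vertex t (c + 1)]%SET.

Lemma tri_vertex_pos (t : index) (c : 'I_3) :
  (tri_vertex t c).1.2 = (t.1.1 + nth 0 [:: 0; 1; 86] c * t.1.2)%N :> nat.
Proof.
rewrite /= inordK //; have := ltn_ord t.1.1; have := ltn_ord t.1.2.
by case: c => -[|[|[|]]] //= _; lia.
Qed.

Lemma tri_arc (t : index) (c : 'I_3) :
  t.1.2 \in A -> arc A (tri_vertex t c) (tri_vertex t (c + 1)).
Proof.
move=> tA; rewrite /arc eqxx; apply/exists_inP; exists t.1.2 => //.
rewrite !tri_vertex_pos /step /=.
by case: c => -[|[|[|]]] //= _; lia.
Qed.

(** Any two of x, x + a, x + 86 a determine x and a, and any two of i, j, i + j determine i and j.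
    So the triangles are edge-disjoint. *)
Lemma tri_edge_inj (t t' : index) (c c' : 'I_3) : tri_edge t c = tri_edge t' c' -> t = t'.
Proof.
move=> e.
have cls_eq d d' : tri_vertex t d = tri_vertex t' d' -> d = d' by move=> [].
have h0 : tri_vertex t c \in tri_edge t' c' by rewrite -e !inE eqxx.
have h1 : tri_vertex t (c + 1) \in tri_edge t' c' by rewrite -e !inE eqxx orbT.
have [ec e0 e1] : [/\ c = c', tri_vertex t c = tri_vertex t' c &
    tri_vertex t (c + 1) = tri_vertex t' (c + 1)].
  have /andP[n1 n2] := ord3_succ_neq c'.
  move: h0 h1; rewrite !inE => /orP[]/eqP h0 /orP[]/eqP h1;
    have c0 := cls_eq _ _ h0; have c1 := cls_eq _ _ h1; subst c => //.
  - by rewrite c1 eqxx in n1.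
  - by rewrite c1 eqxx in n2.
  - by move/addIr/eqP: c1; rewrite (negbTE n1).
have p0 : (tri_vertex t c).1.2 = (tri_vertex t' c).1.2 :> nat by rewrite e0.
have p1 : (tri_vertex t (c + 1)).1.2 = (tri_vertex t' (c + 1)).1.2 :> nat by rewrite e1.
have q0 : (tri_vertex t c).2 = (tri_vertex t' c).2 by rewrite e0.
have q1 : (tri_vertex t (c + 1)).2 = (tri_vertex t' (c + 1)).2 by rewrite e1.
rewrite !tri_vertex_pos in p0 p1.
clear -p0 p1 q0 q1; move: p0 p1 q0 q1.
case: t t' => [[x a] [i j]] [[x' a'] [i' j']].
have comb : x = x' :> nat -> a = a' :> nat -> i = i' -> j = j' ->
    (x, a, (i, j)) = (x', a', (i', j')) by move=> /val_inj -> /val_inj -> -> ->.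
case: c => -[|[|[|]]] //= _ p0 p1.
- by move=> ii jj; apply: comb => //; lia.
- by move=> jj ij; apply: comb; [lia|lia|apply: (@addIr _ j'); rewrite -ij jj|].
- by move=> ij ii; apply: comb; [lia|lia| |apply: (@addrI _ i'); rewrite -ij ii].
Qed.

Lemma cayley_far (R : realType) (eps : R) :
  eps * #|vertex (cayley b A)|%:R ^+ 2 <= (m * #|A| * b.+1 ^ 2)%:R ->
  far_from_triangle_free eps (cayley b A).
Proof.
move=> eps_le F Fsub F_lt tf.
have hit t : t.1.2 \in A -> [exists c, tri_edge t c \in F].
  move=> tA; apply: contraT => /existsPn noF.
  have del c : del_adj F (tri_vertex t c) (tri_vertex t (c + 1)).
    by rewrite /del_adj /= /cayley_adj tri_arc //=; apply: noF.
  have := tf (tri_vertex t 0) (tri_vertex t (0 + 1)) (tri_vertex t (0 + 1 + 1)).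
  rewrite /= !del (_ : tri_vertex t 0 = tri_vertex t (0 + 1 + 1 + 1)) ?del //.
  by congr tri_vertex; apply: val_inj.
pose D : {set index} := (finset.setX (finset.setX [set: 'I_m] A) [set: 'I_b.+1 * 'I_b.+1])%SET.
(* A deleted edge of each triangle; by [hit] the default class 0 does not occur for [t] in [D]. *)
pose E t := tri_edge t (odflt 0 [pick c | tri_edge t c \in F]).
have : (#|(E @: D)%SET| <= #|F|)%N.
  apply/subset_leq_card/fintype.subsetP => e /imsetP[t].
  rewrite !inE /= andbT => tA ->; rewrite /E.
  case: pickP => [c //|no]; have /existsP[c] := hit t tA.
  by rewrite no.
rewrite card_imset; last by move=> t t' /tri_edge_inj.
rewrite !cardsX !cardsT card_prod !card_ord mulnn -(ler_nat R) leNgt.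
by rewrite (lt_le_trans F_lt eps_le).
Qed.

End Far.

(** * From abundance to a contradiction *)

Lemma r_max_witness (k : nat) (a : 'I_k -> int) (m : nat) : (0 < r_max a m)%N ->
  exists2 A : {set 'I_m.+1}, solution_free a A & #|A| = r_max a m.
Proof.
suff [->//|] : r_max a m = 0%N \/
    exists2 A : {set 'I_m.+1}, solution_free a A & #|A| = r_max a m by [].
apply: (big_ind (fun r => r = 0%N \/
    exists2 A : {set 'I_m.+1}, solution_free a A & #|A| = r)); first by left.
- by move=> x y xP yP; rewrite /maxn; case: ifP.
- by move=> A /andP[_ AP]; right; exists A.
Qed.

Lemma card_rigid_base_gt0 : (0 < #|vertex (rigid base_color)|)%N.
Proof. by apply/card_gt0P; exists (inl (1%g, ord0)). Qed.

(** Taking [n0] as blow-up parameter makes the graph large enough. The factor n0 + 1 then cancels,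
    so the bound depends on m and [A] alone, although [n0] depends on [eps]. *)
Lemma abundant_density_bound (R : realType) (C : R) (m : nat) (A : {set 'I_m.+1}) (n0 : nat) :
  let eps : R := #|A|%:R / (264 ^+ 2 * m%:R) in
  (0 < m)%N -> solution_free coef A ->
  (forall G : sgraph, (n0 <= #|vertex G|)%N -> far_from_triangle_free eps G ->
     eps `^ C * #|vertex G|%:R ^+ #|vertex (rigid base_color)|
       <= (copies (rigid base_color) G)%:R) ->
  eps `^ C * m%:R <= (#|vertex (rigid base_color)| ^ 2)%:R.
Proof.
move=> eps m_gt0 Afree ab.
have m0 : (0 : R) < m%:R by rewrite ltr0n.
have nE := card_cayley n0 A; set n := #|vertex (cayley n0 A)| in nE.
have far : far_from_triangle_free eps (cayley n0 A).
  apply: cayley_far.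
  (* 264 = 3 * 88, and 87 m + 1 <= 88 m. *)
  have n_le : (n%:R : R) <= 264 * m%:R * n0.+1%:R.
    by rewrite -!natrM ler_nat nE leq_mul2r /=; lia.
  apply: (@le_trans _ _ (eps * (264 * m%:R * n0.+1%:R) ^+ 2)).
    rewrite ler_wpM2l ?divr_ge0 ?mulr_ge0 ?ler0n //.
    by rewrite ler_sqr ?nnegrE ?mulr_ge0 ?ler0n.
  rewrite /eps !natrM ?natrX le_eqVlt; apply/orP; left; apply/eqP.
  by field; rewrite gt_eqF.
have n0_le : (n0 <= n)%N by rewrite nE -[X in (X <= _)%N]mul1n leq_mul.
have := le_trans (ab (cayley n0 A) n0_le far)
  (etrans (ler_nat R _ _) (copies_cayley_le n0 Afree)).
rewrite -/n; set h := #|vertex (rigid base_color)|.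
have hE : h = h.-1.+1 by rewrite prednK // card_rigid_base_gt0.
have n_gt0 : (0 : R) < n%:R by rewrite ltr0n nE.
rewrite {1}hE exprS !natrM natrX mulrA [X in _ <= X]mulrCA [X in _ <= X]mulrC.
rewrite ler_pM2r ?exprn_gt0 // => le1.
have b0 : (0 : R) < n0.+1%:R by rewrite ltr0n.
rewrite -(ler_pM2r b0); apply: le_trans le1.
rewrite -mulrA ler_wpM2l ?powR_ge0 // -natrM ler_nat nE leq_mul2r /=; lia.
Qed.

Theorem theorem1p6 (R : realType) (genus_conj : ruzsa_genus_conjecture R) :
  exists H : sgraph,
    [/\ triangle_free H, tripartite H & ~ K3_abundant R H].
Proof.
exists (rigid base_color); split.
- exact: rigid_triangle_free base_color_proper base_triangle_free.
- exact: rigid_tripartite base_color_proper.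
move=> [C C0 ab].
have [eta eta0 etaP] := genus_conj _ _ coef_genus_one.
have [K KE] : exists K : R, K = 264 ^+ 2 by exists (264 ^+ 2).
have K0 : 0 < K by rewrite KE exprn_gt0 ?ltr0n.
pose h := #|vertex (rigid base_color)|.
(* With [eta m] at most 1 / (2 C), abundance will yield m^(1/2) <= [L]; so m is also taken larger
   than [L] squared. *)
pose L : R := (h ^ 2)%:R * K `^ C.
have [m [m_gt0 eta_le r_ge L_lt]] : exists m : nat, [/\ (0 < m)%N, eta m <= (2 * C)^-1,
    m%:R `^ (1 - eta m) <= (r_max coef m)%:R & L ^+ 2 < m%:R].
near \oo%classic => m; exists m; split; near: m => //.
  - have : (0 : R) < (2 * C)^-1 by rewrite invr_gt0 mulr_gt0.
    by move=> /(cvgr_lt _ eta0) /filterS; apply => x /ltW.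
  - exact: nbhs_infty_gtr.
have M0 : (0 : R) < m%:R by rewrite ltr0n.
have [A Afree cardA] : exists2 A : {set 'I_m.+1}, solution_free coef A & #|A| = r_max coef m.
  by apply: r_max_witness; rewrite -(ltr_nat R); apply: lt_le_trans r_ge; rewrite powR_gt0.
rewrite -cardA in r_ge.
pose eps : R := #|A|%:R / (K * m%:R).
have eps_ge : m%:R `^ (- eta m) / K <= eps.
  have -> : eps = #|A|%:R / m%:R / K by rewrite /eps; field; rewrite !gt_eqF.
  rewrite ler_wpM2r ?invr_ge0 ?(ltW K0) //.
  rewrite ler_pdivlMr //; apply: le_trans r_ge.
  by rewrite powRD ?(gt_eqF M0) ?implybT // powRr1 ?(ltW M0) // mulrC.
have eps_half : 0 < eps <= 1 / 2.
  rewrite (lt_le_trans _ eps_ge) ?divr_gt0 ?powR_gt0 //=.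
  rewrite ler_pdivrMr ?mulr_gt0 //.
  (* As m + 1 <= 2 m, [eps] is at most 2 / [K], far below 1 / 2. *)
  have : (#|A|%:R : R) <= m%:R + 1.
    by rewrite natr1 ler_nat (leq_trans (max_card _)) // card_ord.
  have : (1 : R) <= m%:R by rewrite ler1n.
  rewrite KE expr2; lra.
have bound : eps `^ C * m%:R <= (h ^ 2)%:R.
  have [n0] := ab eps eps_half; rewrite /eps KE.
  exact: abundant_density_bound.
have epsC : m%:R `^ (- 2^-1) / K `^ C <= eps `^ C.
  apply: (@le_trans _ _ ((m%:R `^ (- eta m) / K) `^ C)); last first.
    apply: ge0_ler_powR eps_ge; rewrite ?nnegrE; first exact: ltW.
      by rewrite divr_ge0 ?powR_ge0 // ltW.
    by case/andP: eps_half => /ltW.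
  rewrite powRM ?powR_ge0 ?invr_ge0 ?(ltW K0) // -powRrM.
  rewrite -[K^-1]powR_inv1 ?(ltW K0) // -powRrM mulN1r [K `^ (- C)]powRN.
  rewrite ler_wpM2r ?invr_ge0 ?powR_ge0 // ler_powR ?ler1n //.
  by rewrite mulNr lerN2 -ler_pdivlMr // -invfM.
have sq : m%:R `^ 2^-1 <= L.
  rewrite -ler_pdivrMr ?powR_gt0 //; apply: le_trans bound.
  apply: le_trans (ler_wpM2r (ltW M0) epsC).
  rewrite mulrAC ler_wpM2r ?invr_ge0 ?powR_ge0 //.
  rewrite -[X in _ <= _ * X](powRr1 (ltW M0)) -powRD ?(gt_eqF M0) ?implybT //.
  by rewrite (_ : - 2^-1 + 1 = 2^-1) //; field.
have : (m%:R : R) <= L ^+ 2.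
  have -> : m%:R = (m%:R `^ 2^-1) ^+ 2 :> R.
    by rewrite -powR_mulrn ?powR_ge0 // -powRrM mulVf ?powRr1 ?(ltW M0) ?pnatr_eq0.
  by rewrite ler_sqr ?nnegrE ?powR_ge0 // (le_trans _ sq) ?powR_ge0.
by rewrite leNgt L_lt.
Unshelve. all: by end_near.
Qed.
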